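(* There exists a small enough universal constant $\epsilon_0>0$ such that the following holds. Let $4<D_0<\frac{1}{4\epsilon_0}$. Let $\Delta>0$ and let $g\in D^\omega(\mathbb{T},\Delta)$ have irrational rotation number, be holomorphic on $B_\Delta$ and continuous on $\overline{B_\Delta}$, and satisfy $\|D\log Dg\|_{C^0(\overline{B_\Delta})}<\epsilon_0$. Then there exist $n_0\ge 1$ and a constant $C_0>0$ such that for all $n>n_0$, for all $z_0\in B_\Delta$ with $\Im z_0>0$ of the form $z_0=x_0+i\,|m_n(x_0)|\,y_0$ with $x_0\in\mathbb{R}$ and $0<y_0<D_0$, and for all $0\le j\le q_{n+1}$, $$d_P\big(g^j(z_0),\varphi^{(n)}_j(z_0)\big)\le C_0 .$$
   Context: $D^\omega(\mathbb{T})$ is the space of increasing real-analytic diffeomorphisms $g$ of $\mathbb{R}$ with $g(x+1)=g(x)+1$ for all $x$; $\rho(g)\in\mathbb{R}$ is the rotation number. $B_\Delta=\{z\in\mathbb{C}: |\Im z|<\Delta\}$, and $D^\omega(\mathbb{T},\Delta)$ is the set of $g\in D^\omega(\mathbb{T})$ that extend to a holomorphic diffeomorphism, still denoted $g$, such that $g$ and $g^{-1}$ are defined on $B_\Delta$. $D$ denotes the derivative. Put $\alpha=\rho(g)$ (irrational), with continued fraction convergents $(p_n/q_n)_{n\ge0}$, and $m_n(x)=g^{q_n}(x)-x-p_n$ for $x\in\mathbb{R}$. By Denjoy's theorem there is an increasing homeomorphism $h:\mathbb{R}\to\mathbb{R}$ with $h(x+1)=h(x)+1$ and $h^{-1}\circ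 g\circ h=T_\alpha$, where $T_s(x)=x+s$. Define the flow $\varphi_t=h\circ T_{t\alpha}\circ h^{-1}$ on $\mathbb{R}$, $t\in\mathbb{R}$ (so $\varphi_j=g^j$ on $\mathbb{R}$ for $j\in\mathbb{Z}$). For $n\ge0$ it is extended to $\mathbb{C}$ by: for $z_0=x_0+i|m_n(x_0)|y_0$ with $x_0,y_0\in\mathbb{R}$, $$\varphi^{(n)}_t(z_0)=\varphi_t(x_0)+i\,|m_n(\varphi_t(x_0))|\,y_0 .$$ $d_P$ is the Poincaré distance in the upper half plane (metric $|d\xi|/\Im\xi$). The inequality includes the assertion that $g^j(z_0)$ is defined and lies in the upper half plane. *)

(* Defs.v *)
(* Stdlib reals and Coquelicot. *)
From Stdlib Require Import Reals ZArith.
From Coquelicot Require Import Coquelicot.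
Open Scope R_scope.

Definition irrational (a : R) : Prop :=
  ~ exists p q : Z, q <> 0%Z /\ a = IZR p / IZR q.

Definition increasing (f : R -> R) : Prop :=
  forall x y : R, x < y -> f x < f y.

Definition inverse_of (f finv : R -> R) : Prop :=
  (forall x : R, finv (f x) = x) /\ (forall x : R, f (finv x) = x).

(** * Analytic diffeomorphisms of the circle, lifted to the line *)

Definition real_analytic (f : R -> R) : Prop :=
  forall x0 : R, exists (a : nat -> R) (r : R), 0 < r /\
    forall x : R, Rabs (x - x0) < r -> is_pseries a (x - x0) (f x).

Definition Domega (g : R -> R) : Prop :=
  increasing g /\
  (forall x : R, g (x + 1) = g x + 1) /\
  real_analytic g /\
  exists ginv : R -> R, inverse_of g ginv /\ real_analytic ginv.

Definition rotation_number (g : R -> R) : R :=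
  real (Lim_seq (fun n : nat => Nat.iter n g 0 / INR n)).

(** * Holomorphic extension to a strip *)

Definition strip (Delta : R) (z : C) : Prop := Rabs (Im z) < Delta.
Definition closed_strip (Delta : R) (z : C) : Prop := Rabs (Im z) <= Delta.

Definition holomorphic_on (U : C -> Prop) (f : C -> C) : Prop :=
  forall z : C, U z -> ex_derive (K := C_AbsRing) (V := C_NormedModule) f z.

(** [G] is total; only its values on the domain [U] of the extension (and, when
    continuity on the closed strip is required, on that closed strip) matter. *)
Definition Domega_strip (Delta : R) (g : R -> R) (G : C -> C) : Prop :=
  Domega g /\
  (forall x : R, G (RtoC x) = RtoC (g x)) /\
  exists (U V : C -> Prop) (Ginv : C -> C),
    open U /\ open V /\
    (forall z : C, strip Delta z -> U z) /\
    (forall z : C, strip Delta z -> V z) /\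
    holomorphic_on U G /\ holomorphic_on V Ginv /\
    (forall z : C, U z -> V (G z) /\ Ginv (G z) = z) /\
    (forall w : C, V w -> U (Ginv w) /\ G (Ginv w) = w).

Definition Cexp (z : C) : C :=
  (exp (Re z) * cos (Im z), exp (Re z) * sin (Im z)).

(** [L] is [D log DG] as an element of C^0 of the closed strip: [l] is a branch
    of [log DG] on the open strip, [L] its derivative there, and [L] is extended
    to the boundary by continuity.  [L] does not depend on the branch. *)
Definition is_DlogD (Delta : R) (G L : C -> C) : Prop :=
  (exists l : C -> C, forall z : C, strip Delta z ->
     is_derive (K := C_AbsRing) (V := C_NormedModule) G z (Cexp (l z)) /\
     is_derive (K := C_AbsRing) (V := C_NormedModule) l z (L z)) /\
  continuous_on (closed_strip Delta) L.

Definition C0_norm (K : C -> Prop) (f : C -> C) : Rbar :=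
  Lub_Rbar (fun r : R => exists z : C, K z /\ r = Cmod (f z)).

(** * Continued fractions *)

Fixpoint complete_quotient (a : R) (n : nat) : R :=
  match n with
  | O => a
  | S k => / frac_part (complete_quotient a k)
  end.

(** [Int_part] is the floor function, also for negative arguments. *)
Definition partial_quotient (a : R) (n : nat) : Z :=
  Int_part (complete_quotient a n).

(** p_0 = a_0, p_1 = a_1 a_0 + 1 and q_0 = 1, q_1 = a_1.  The quotients a_n with
    n >= 1 are positive when [a] is irrational, so [Z.to_nat] loses nothing. *)
Fixpoint cf_num (a : R) (n : nat) : Z :=
  match n with
  | O => partial_quotient a 0
  | S k =>
      match k with
      | O => partial_quotient a 1 * partial_quotient a 0 + 1
      | S j => partial_quotient a n * cf_num a k + cf_num a j
      end
  end%Z.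

Fixpoint cf_den (a : R) (n : nat) : nat :=
  match n with
  | O => 1
  | S k =>
      match k with
      | O => Z.to_nat (partial_quotient a 1)
      | S j => Z.to_nat (partial_quotient a n) * cf_den a k + cf_den a j
      end
  end%nat.

Definition m (g : R -> R) (n : nat) (x : R) : R :=
  Nat.iter (cf_den (rotation_number g) n) g x - x
  - IZR (cf_num (rotation_number g) n).

(** * The conjugacy to a rotation and the flow it defines *)

Definition conjugacy (g h hinv : R -> R) : Prop :=
  increasing h /\ inverse_of h hinv /\
  (forall x : R, continuous h x) /\ (forall x : R, continuous hinv x) /\
  (forall x : R, h (x + 1) = h x + 1) /\
  (forall x : R, hinv (g (h x)) = x + rotation_number g).

Definition flow (g h hinv : R -> R) (t x : R) : R :=
  h (hinv x + t * rotation_number g).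

(** For irrational rotation number [m g n] never vanishes, so that
    z = x0 + i |m_n(x0)| y0 determines x0 = Re z and y0 = Im z / |m_n(x0)|. *)
Definition flow_ext (g h hinv : R -> R) (n : nat) (t : R) (z : C) : C :=
  let x0 := Re z in
  let y0 := Im z / Rabs (m g n x0) in
  (flow g h hinv t x0, Rabs (m g n (flow g h hinv t x0)) * y0).

(** * Poincaré distance of the upper half plane *)

Definition half_plane_path (z w : C) (x y : R -> R) : Prop :=
  (x 0, y 0) = z /\ (x 1, y 1) = w /\
  forall t : R, 0 <= t <= 1 ->
    0 < y t /\
    ex_derive x t /\ continuous (Derive x) t /\
    ex_derive y t /\ continuous (Derive y) t.

Definition hyperbolic_length (x y : R -> R) : R :=
  RInt (fun t : R => sqrt (Derive x t ^ 2 + Derive y t ^ 2) / y t) 0 1.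

(** Infimum of the lengths of C^1 paths; it is [p_infty] as soon as one of the
    points is not in the upper half plane. *)
Definition poincare_dist (z w : C) : Rbar :=
  Glb_Rbar (fun r : R => exists x y : R -> R,
    half_plane_path z w x y /\ r = hyperbolic_length x y).

(* Main.v *)
Require Import Defs.
From Stdlib Require Import Reals ZArith Lra Lia.
From Coquelicot Require Import Coquelicot.
Open Scope R_scope.

(** Write [x_i = g^i(x_0)], [mu_i = m_n(x_i)] and [g^i(z_0) = x_i + mu_i v_i].
    The estimate says that the complex number [v_i], which is [i y_0] up to a
    sign when [i = 0], hardly moves during [q_{n+1}] iterations.

    Since [g] commutes with [g^{q_n} - p_n], it sends the pair
    [(x_i, x_i + mu_i)] to [(x_{i+1}, x_{i+1} + mu_{i+1})]; so [mu] and [mu v]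
    are both transported by difference quotients of [g] based at [x_i].  As
    [D log Dg] is at most [eps], such a quotient over a displacement [w] equals
    [Dg(x_i)] up to a relative error of order [eps |w|] (lemma [distortion]).
    The factor [Dg(x_i)] cancels in [v_{i+1} / v_i], and what is left is an
    error of order [eps (1 + |v_i|) |mu_i|] (lemma [ratio_distortion]).

    These errors are summable because the intervals between [x_i] and
    [x_i + mu_i], for [i < q_{n+1}], are disjoint modulo 1, whence
    [sum |mu_i| <= 1] (lemma [sum_m_orbit_le_1]).  Through [h] this is a
    statement on the rotation: the points [i alpha] with [i < q_{n+1}] are
    separated modulo 1 by at least [|q_n alpha - p_n|], because the convergents
    are best approximations (lemma [best_approximation]).

    With [eps |v_0| <= 1/4] the accumulated relative error of [v] stays below
    [0.88] (lemma [orbit_shadowing]).  Hence the segment from [g^j(z_0)] to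
    [x_j + i |mu_j| y_0], which is the value of the flow, has length at most
    [0.88 |mu_j| y_0] and stays above height [0.12 |mu_j| y_0]: its hyperbolic
    length is less than 8.  Large [n] only serves to make [mu_i] small, which
    keeps the orbit in the strip and close to the real line. *)

(** * Continued fractions and best approximation *)

Lemma irrational_Rinv_frac_part (a : R) :
  irrational a -> irrational (/ frac_part a).
Proof.
  intros Ha [p [q [Hq E]]]. apply Ha.
  assert (Ef : frac_part a = IZR q / IZR p).
  { rewrite <- (Rinv_inv (frac_part a)), E. rewrite Rinv_div. reflexivity. }
  unfold frac_part in Ef.
  destruct (Z.eq_dec p 0) as [-> | Hp].
  - exists (Int_part a), 1%Z. split; [lia|].
    unfold Rdiv in Ef. rewrite Rinv_0 in Ef. lra.
  - exists (Int_part a * p + q)%Z, p. split; [assumption|].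
    rewrite plus_IZR, mult_IZR.
    assert (IZR p <> 0) by now apply not_0_IZR.
    replace a with (IZR (Int_part a) + IZR q / IZR p) at 1 by lra.
    field. assumption.
Qed.

Lemma irrational_complete_quotient (a : R) (n : nat) :
  irrational a -> irrational (complete_quotient a n).
Proof.
  intros Ha. induction n as [|n IH]; [exact Ha|].
  now apply irrational_Rinv_frac_part.
Qed.

Lemma irrational_frac_part (a : R) : irrational a -> 0 < frac_part a < 1.
Proof.
  intros Ha. destruct (base_fp a) as [H0 H1]. split; [|assumption].
  destruct (Req_dec (frac_part a) 0) as [E|]; [|lra].
  exfalso. apply Ha. exists (Int_part a), 1%Z. split; [lia|].
  unfold frac_part in E. lra.
Qed.

Lemma frac_part_complete_quotient (a : R) (n : nat) :
  irrational a -> 0 < frac_part (complete_quotient a n) < 1.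
Proof.
  intros Ha. now apply irrational_frac_part, irrational_complete_quotient.
Qed.

Lemma partial_quotient_eq (a : R) (n : nat) :
  IZR (partial_quotient a n)
  = complete_quotient a n - frac_part (complete_quotient a n).
Proof. unfold partial_quotient, frac_part. ring. Qed.

Lemma partial_quotient_pos (a : R) (n : nat) :
  irrational a -> (1 <= partial_quotient a (S n))%Z.
Proof.
  intros Ha.
  pose proof (frac_part_complete_quotient a n Ha) as Hn.
  pose proof (frac_part_complete_quotient a (S n) Ha) as HSn.
  pose proof (partial_quotient_eq a (S n)) as E.
  assert (1 < complete_quotient a (S n)).
  { simpl. rewrite <- Rinv_1. apply Rinv_lt_contravar; lra. }
  assert (0 < partial_quotient a (S n))%Z by (apply lt_IZR; lra). lia.
Qed.

Lemma cf_den_SS (a : R) (n : nat) :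
  irrational a ->
  Z.of_nat (cf_den a (S (S n)))
  = (partial_quotient a (S (S n)) * Z.of_nat (cf_den a (S n))
     + Z.of_nat (cf_den a n))%Z.
Proof.
  intros Ha. pose proof (partial_quotient_pos a (S n) Ha).
  change (cf_den a (S (S n))) with
    (Z.to_nat (partial_quotient a (S (S n))) * cf_den a (S n) + cf_den a n)%nat.
  rewrite Nat2Z.inj_add, Nat2Z.inj_mul, Z2Nat.id by lia. reflexivity.
Qed.

Lemma cf_num_SS (a : R) (n : nat) :
  cf_num a (S (S n))
  = (partial_quotient a (S (S n)) * cf_num a (S n) + cf_num a n)%Z.
Proof. reflexivity. Qed.

Lemma cf_den_1 (a : R) :
  irrational a -> Z.of_nat (cf_den a 1) = partial_quotient a 1.
Proof.
  intros Ha. pose proof (partial_quotient_pos a 0 Ha).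
  change (cf_den a 1) with (Z.to_nat (partial_quotient a 1)). lia.
Qed.

(** Squaring absorbs the alternating sign of the determinant. *)
Lemma cf_determinant (a : R) (n : nat) :
  irrational a ->
  let d := (Z.of_nat (cf_den a (S n)) * cf_num a n
            - Z.of_nat (cf_den a n) * cf_num a (S n))%Z in
  (d * d = 1)%Z.
Proof.
  intros Ha. induction n as [|n IH]; cbv zeta in *.
  - rewrite cf_den_1 by assumption. simpl cf_num. simpl cf_den.
    change (Z.of_nat 1) with 1%Z. ring.
  - rewrite cf_den_SS, cf_num_SS by assumption.
    rewrite <- IH. ring.
Qed.

(** The signed error of the [n]-th convergent; modulo 1 it is the displacement
    of the rotation iterated [q_n] times. *)
Definition beta (a : R) (n : nat) : R :=
  INR (cf_den a n) * a - IZR (cf_num a n).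

Lemma beta_SS (a : R) (n : nat) :
  irrational a ->
  beta a (S (S n))
  = IZR (partial_quotient a (S (S n))) * beta a (S n) + beta a n.
Proof.
  intros Ha. unfold beta. rewrite !INR_IZR_INZ, cf_den_SS, cf_num_SS by assumption.
  rewrite !plus_IZR, !mult_IZR. ring.
Qed.

Lemma beta_0 (a : R) : beta a 0 = frac_part a.
Proof. unfold beta, frac_part. simpl. unfold partial_quotient. simpl. ring. Qed.

(** Successive errors are in the ratio minus the fractional part of the
    complete quotient; the alternation of their signs and their decay follow. *)
Lemma beta_S (a : R) (n : nat) :
  irrational a ->
  beta a (S n) = - frac_part (complete_quotient a (S n)) * beta a n.
Proof.
  intros Ha. induction n as [|n IH].
  - assert (E : beta a 1 = IZR (partial_quotient a 1) * beta a 0 - 1).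
    { unfold beta. rewrite !INR_IZR_INZ, cf_den_1 by assumption. simpl.
      rewrite plus_IZR, mult_IZR. ring. }
    rewrite E, partial_quotient_eq, beta_0. simpl.
    pose proof (irrational_frac_part a Ha). field. lra.
  - rewrite beta_SS, partial_quotient_eq by assumption.
    pose proof (frac_part_complete_quotient a (S n) Ha).
    assert (En : beta a n
      = - / frac_part (complete_quotient a (S n)) * beta a (S n)).
    { rewrite IH. field. lra. }
    rewrite En.
    change (complete_quotient a (S (S n)))
      with (/ frac_part (complete_quotient a (S n))). ring.
Qed.

Lemma beta_neq_0 (a : R) (n : nat) : irrational a -> beta a n <> 0.
Proof.
  intros Ha. induction n as [|n IH].
  - rewrite beta_0. pose proof (irrational_frac_part a Ha). lra.
  - rewrite beta_S by assumption.
    pose proof (frac_part_complete_quotient a (S n) Ha). nra.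
Qed.

Lemma beta_alternate (a : R) (n : nat) :
  irrational a ->
  0 < beta a n /\ beta a (S n) < 0 \/ beta a n < 0 /\ 0 < beta a (S n).
Proof.
  intros Ha. rewrite beta_S by assumption.
  pose proof (frac_part_complete_quotient a (S n) Ha).
  destruct (Rtotal_order (beta a n) 0) as [|[E|]].
  - right. nra.
  - now apply beta_neq_0 in E.
  - left. nra.
Qed.

Lemma Rabs_beta_S (a : R) (n : nat) :
  irrational a -> Rabs (beta a (S n)) <= Rabs (beta a n).
Proof.
  intros Ha. rewrite beta_S, Rabs_mult, Rabs_Ropp by assumption.
  pose proof (frac_part_complete_quotient a (S n) Ha).
  rewrite (Rabs_pos_eq (frac_part _)) by lra.
  pose proof (Rabs_pos (beta a n)). nra.
Qed.

Lemma Rabs_beta_le_1 (a : R) (n : nat) :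
  irrational a -> Rabs (beta a n) <= 1.
Proof.
  intros Ha. induction n as [|n IH].
  - rewrite beta_0. pose proof (irrational_frac_part a Ha).
    rewrite Rabs_pos_eq; lra.
  - pose proof (Rabs_beta_S a n Ha). lra.
Qed.

(** If [f] is the fractional part of one complete quotient, the next one is
    [1/f - a] with [a >= 1], so the product of the two is at most
    [min(f, 1 - f) <= 1/2]. *)
Lemma Rabs_beta_SS (a : R) (n : nat) :
  irrational a -> Rabs (beta a (S (S n))) <= Rabs (beta a n) / 2.
Proof.
  intros Ha. rewrite !beta_S by assumption.
  set (f := frac_part (complete_quotient a (S n))).
  set (f' := frac_part (complete_quotient a (S (S n)))).
  assert (0 < f < 1) by now apply frac_part_complete_quotient.
  assert (0 < f' < 1) by now apply frac_part_complete_quotient.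
  assert (Hp : f * f' <= 1 - f).
  { pose proof (partial_quotient_eq a (S (S n))) as E.
    change (complete_quotient a (S (S n))) with (/ f) in E at 1.
    fold f' in E.
    replace f' with (/ f - IZR (partial_quotient a (S (S n)))) by lra.
    pose proof (IZR_le _ _ (partial_quotient_pos a (S n) Ha)).
    rewrite Rmult_minus_distr_l, Rinv_r by lra. nra. }
  assert (f * f' <= 1 / 2) by nra.
  replace (- f' * (- f * beta a n)) with (f * f' * beta a n) by ring.
  rewrite Rabs_mult, (Rabs_pos_eq (f * f')) by nra.
  pose proof (Rabs_pos (beta a n)). nra.
Qed.

Lemma Rabs_beta_pow (a : R) (k : nat) :
  irrational a -> Rabs (beta a (2 * k)) <= (1 / 2) ^ k.
Proof.
  intros Ha. induction k as [|k IH].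
  - apply Rabs_beta_le_1, Ha.
  - replace (2 * S k)%nat with (S (S (2 * k))) by lia.
    pose proof (Rabs_beta_SS a (2 * k) Ha). simpl pow. lra.
Qed.

Lemma beta_cvg_0 (a : R) :
  irrational a ->
  forall eps : R, 0 < eps ->
  exists N : nat, forall n : nat, (N <= n)%nat -> Rabs (beta a n) < eps.
Proof.
  intros Ha eps Heps.
  destruct (pow_lt_1_zero (1 / 2)) with (y := eps) as [k Hk];
    [rewrite Rabs_pos_eq; lra | assumption |].
  exists (2 * k)%nat. intros n Hn. induction Hn as [|n Hn IH].
  - pose proof (Rabs_beta_pow a k Ha) as Hb.
    specialize (Hk k (Nat.le_refl k)).
    pose proof (Rle_abs ((1 / 2) ^ k)). lra.
  - pose proof (Rabs_beta_S a n Ha). lra.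
Qed.

(** The determinant is 1 or -1, so [(k, p)] is an integral combination [u, v]
    of two consecutive convergents.  As [0 < k < q_{n+1}], [u] is not 0 and [v]
    is 0 or of sign opposite to [u]; the errors of the two convergents also have
    opposite signs, so their contributions to [k a - p] add up. *)
Lemma best_approximation (a : R) (n : nat) (k : nat) (p : Z) :
  irrational a -> (0 < k < cf_den a (S n))%nat ->
  Rabs (beta a n) <= Rabs (INR k * a - IZR p).
Proof.
  intros Ha Hk.
  set (q := Z.of_nat (cf_den a n)). set (q' := Z.of_nat (cf_den a (S n))).
  set (r := cf_num a n). set (r' := cf_num a (S n)).
  set (s := (q' * r - q * r')%Z).
  assert (Hs : (s * s = 1)%Z) by exact (cf_determinant a n Ha).
  (* Cramer's rule; [s] is its own inverse. *)
  set (u := (s * (p * q' - Z.of_nat k * r'))%Z).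
  set (v := (s * (Z.of_nat k * r - p * q))%Z).
  assert (Ek : Z.of_nat k = (u * q + v * q')%Z).
  { transitivity (s * s * Z.of_nat k)%Z; [rewrite Hs|unfold u, v, s]; ring. }
  assert (Ep : p = (u * r + v * r')%Z).
  { transitivity (s * s * p)%Z; [rewrite Hs|unfold u, v, s]; ring. }
  assert (E : INR k * a - IZR p = IZR u * beta a n + IZR v * beta a (S n)).
  { unfold beta. rewrite !INR_IZR_INZ. fold q q' r r'. rewrite Ek, Ep.
    rewrite !plus_IZR, !mult_IZR. ring. }
  rewrite E.
  assert (0 <= q)%Z by lia. assert (0 < Z.of_nat k < q')%Z by lia.
  pose proof (beta_alternate a n Ha) as Hb.
  assert (Hc : (1 <= u /\ v <= 0)%Z \/ (u <= -1 /\ 0 <= v)%Z).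
  { clearbody u v q q'. clear - Ek H H0. rewrite Ek in H0.
    destruct (Z_lt_le_dec u 1); destruct (Z_lt_le_dec v 1).
    - destruct (Z.eq_dec v 0); [nia|]. nia.
    - destruct (Z_lt_le_dec u 0); nia.
    - nia.
    - nia. }
  destruct Hc as [[Hu Hv] | [Hu Hv]]; apply IZR_le in Hu; apply IZR_le in Hv;
  destruct Hb as [[Hb1 Hb2] | [Hb1 Hb2]].
  - rewrite (Rabs_pos_eq (beta a n)), Rabs_pos_eq by nra. nra.
  - rewrite (Rabs_left (beta a n)), Rabs_left1 by nra. nra.
  - rewrite (Rabs_pos_eq (beta a n)), Rabs_left1 by nra. nra.
  - rewrite (Rabs_left (beta a n)), Rabs_pos_eq by nra. nra.
Qed.

(** * Disjoint intervals on the circle *)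

Fixpoint sum_below (f : nat -> R) (n : nat) : R :=
  match n with
  | O => 0
  | S k => sum_below f k + f k
  end.

Lemma sum_below_ext (f f' : nat -> R) (n : nat) :
  (forall i : nat, (i < n)%nat -> f i = f' i) ->
  sum_below f n = sum_below f' n.
Proof.
  intros H. induction n as [|n IH]; simpl; [reflexivity|].
  rewrite IH, H; auto with arith.
Qed.

Lemma sum_below_plus (f f' : nat -> R) (n : nat) :
  sum_below (fun i => f i + f' i) n = sum_below f n + sum_below f' n.
Proof. induction n as [|n IH]; simpl; [|rewrite IH]; ring. Qed.

Lemma sum_below_scal (k : R) (f : nat -> R) (n : nat) :
  sum_below (fun i => k * f i) n = k * sum_below f n.
Proof. induction n as [|n IH]; simpl; [|rewrite IH]; ring. Qed.

Lemma sum_below_mono (f : nat -> R) (i n : nat) :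
  (forall i : nat, 0 <= f i) -> (i <= n)%nat -> sum_below f i <= sum_below f n.
Proof.
  intros Hf Hi. induction Hi as [|n Hi IH]; simpl; [lra|].
  specialize (Hf n). lra.
Qed.

Definition clip (a c x : R) : R := Rmax a (Rmin c x).

(** Increment of [h] over the part of [[t, t + b]] that lies in [[a, c]]. *)
Definition clipped_increment (h : R -> R) (b a c t : R) : R :=
  h (clip a c (t + b)) - h (clip a c t).

(** An interval disjoint from [[s, s + b]] lies in one of the two pieces that
    remain of [[a, c]] when [[s, s + b]] is removed, and meets the other in at
    most an end point. *)
Lemma clipped_increment_split (h : R -> R) (a b c s t : R) :
  0 <= b -> a <= c -> t + b <= s \/ s + b <= t ->
  clipped_increment h b a c t
  = clipped_increment h b a (clip a c s) t
    + clipped_increment h b (clip a c (s + b)) c t.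
Proof.
  intros Hb Hac [H|H]; unfold clipped_increment.
  - replace (clip a (clip a c s) (t + b)) with (clip a c (t + b))
      by (unfold clip, Rmax, Rmin; repeat destruct Rle_dec; lra).
    replace (clip a (clip a c s) t) with (clip a c t)
      by (unfold clip, Rmax, Rmin; repeat destruct Rle_dec; lra).
    replace (clip (clip a c (s + b)) c (t + b)) with (clip (clip a c (s + b)) c t)
      by (unfold clip, Rmax, Rmin; repeat destruct Rle_dec; lra).
    ring.
  - replace (clip (clip a c (s + b)) c (t + b)) with (clip a c (t + b))
      by (unfold clip, Rmax, Rmin; repeat destruct Rle_dec; lra).
    replace (clip (clip a c (s + b)) c t) with (clip a c t)
      by (unfold clip, Rmax, Rmin; repeat destruct Rle_dec; lra).
    replace (clip a (clip a c s) (t + b)) with (clip a (clip a c s) t)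
      by (unfold clip, Rmax, Rmin; repeat destruct Rle_dec; lra).
    ring.
Qed.

(** Clipping lets the induction remove the last interval from [[a, c]] and use
    the hypothesis on both remaining pieces with the same family of intervals,
    so the intervals need not be sorted. *)
Lemma sum_clipped_increment (h : R -> R) (b : R) (t : nat -> R) (n : nat) :
  Defs.increasing h -> 0 <= b ->
  (forall i j : nat, (i < j < n)%nat -> t i + b <= t j \/ t j + b <= t i) ->
  forall a c : R, a <= c ->
  sum_below (fun i => clipped_increment h b a c (t i)) n <= h c - h a.
Proof.
  intros Hh Hb.
  assert (Hle : forall x y, x <= y -> h x <= h y).
  { intros x y [Hxy | ->]; [left; exact (Hh x y Hxy) | right; reflexivity]. }
  induction n as [|n IH]; intros Hsep a c Hac; simpl.
  - specialize (Hle a c Hac). lra.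
  - rewrite (sum_below_ext _ (fun i =>
      clipped_increment h b a (clip a c (t n)) (t i)
      + clipped_increment h b (clip a c (t n + b)) c (t i))).
    2:{ intros i Hi. apply clipped_increment_split; auto with arith. }
    rewrite sum_below_plus.
    assert (Hsep' : forall i j : nat, (i < j < n)%nat ->
      t i + b <= t j \/ t j + b <= t i) by (intros; apply Hsep; lia).
    assert (a <= clip a c (t n)) by apply Rmax_l.
    assert (clip a c (t n + b) <= c)
      by (unfold clip, Rmax, Rmin; repeat destruct Rle_dec; lra).
    pose proof (IH Hsep' a (clip a c (t n)) ltac:(assumption)).
    pose proof (IH Hsep' (clip a c (t n + b)) c ltac:(assumption)).
    unfold clipped_increment at 3. lra.
Qed.

Lemma shift_IZR (h : R -> R) :
  (forall x : R, h (x + 1) = h x + 1) ->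
  forall (k : Z) (x : R), h (x + IZR k) = h x + IZR k.
Proof.
  intros H1.
  assert (Hn : forall (n : nat) (x : R), h (x + INR n) = h x + INR n).
  { induction n as [|n IH]; intros x.
    - simpl. now rewrite !Rplus_0_r.
    - rewrite S_INR, <- Rplus_assoc, H1, IH. ring. }
  intros k x. destruct (Z_le_gt_dec 0 k) as [Hk|Hk].
  - rewrite <- (Z2Nat.id k) by assumption. rewrite <- INR_IZR_INZ. apply Hn.
  - pose proof (Hn (Z.to_nat (- k)) (x + IZR k)) as E.
    rewrite INR_IZR_INZ, Z2Nat.id, opp_IZR in E by lia.
    replace (x + IZR k + - IZR k) with x in E by ring. lra.
Qed.

(** The translates of the intervals that start in [[s, s + 1)] are disjoint, and
    none leaves [[s, s + 1]]: the first one starts at [s] itself, so the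
    separation modulo 1 from it keeps every other one away from [s + 1]. *)
Lemma sum_increments_le_1 (h : R -> R) (a b s : R) (n : nat) :
  Defs.increasing h -> (forall x : R, h (x + 1) = h x + 1) ->
  0 <= b <= 1 ->
  (forall (k : nat) (p : Z), (0 < k < n)%nat -> b <= Rabs (INR k * a - IZR p)) ->
  sum_below (fun i => h (s + INR i * a + b) - h (s + INR i * a)) n <= 1.
Proof.
  intros Hh H1 Hb Hsep.
  (* [t i] is the representative of [s + i a] modulo 1 in [[s, s + 1)]. *)
  set (t := fun i => s + frac_part (INR i * a)).
  assert (Et : forall i, t i = s + INR i * a + IZR (- Int_part (INR i * a))).
  { intros i. unfold t, frac_part. rewrite opp_IZR. ring. }
  assert (Hgap : forall i, (0 < i < n)%nat -> t i + b <= s + 1).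
  { intros i Hi. pose proof (Hsep i (Int_part (INR i * a) + 1)%Z Hi) as H.
    rewrite plus_IZR in H. destruct (base_fp (INR i * a)) as [_ Hf].
    rewrite Rabs_left in H; unfold t, frac_part in *; lra. }
  apply Rle_trans with (h (s + 1) - h s); [|rewrite H1; lra].
  rewrite (sum_below_ext _ (fun i => clipped_increment h b s (s + 1) (t i))).
  - apply sum_clipped_increment; try assumption; try lra.
    intros i j Hij.
    pose proof (Hsep (j - i)%nat
      (Int_part (INR j * a) - Int_part (INR i * a))%Z ltac:(lia)) as H.
    rewrite minus_INR, minus_IZR in H by lia.
    replace ((INR j - INR i) * a
      - (IZR (Int_part (INR j * a)) - IZR (Int_part (INR i * a))))
      with (t j - t i) in H by (unfold t, frac_part; ring).
    revert H. unfold Rabs. destruct Rcase_abs; lra.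
  - intros i Hi. unfold clipped_increment.
    destruct (base_fp (INR i * a)) as [Hf0 Hf1].
    assert (s <= t i <= s + 1) by (unfold t; lra).
    assert (t i + b <= s + 1).
    { destruct i as [|i]; [|apply Hgap; lia].
      unfold t. simpl. rewrite Rmult_0_l.
      rewrite fp_R0. lra. }
    replace (clip s (s + 1) (t i + b))
      with (s + INR i * a + b + IZR (- Int_part (INR i * a))).
    2:{ pose proof (Et i).
        unfold clip, Rmax, Rmin; repeat destruct Rle_dec; lra. }
    replace (clip s (s + 1) (t i))
      with (s + INR i * a + IZR (- Int_part (INR i * a))).
    2:{ pose proof (Et i).
        unfold clip, Rmax, Rmin; repeat destruct Rle_dec; lra. }
    rewrite !(shift_IZR h H1). ring.
Qed.

Lemma uniform_continuity_circle (h : R -> R) :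
  (forall x : R, continuous h x) -> (forall x : R, h (x + 1) = h x + 1) ->
  forall eta : R, 0 < eta ->
  exists delta : R, 0 < delta /\
    forall s b : R, Rabs b < delta -> Rabs (h (s + b) - h s) < eta.
Proof.
  intros Hc H1 eta Heta.
  destruct (@Heine_cor2 h (-1) 2
    (fun x _ => proj2 (continuity_pt_filterlim h x) (Hc x))
    (mkposreal eta Heta)) as [d Hd].
  exists (Rmin d 1). split; [apply Rmin_case; [apply cond_pos | lra]|].
  intros s b Hb.
  pose proof (Rmin_l d 1). pose proof (Rmin_r d 1).
  destruct (base_fp s) as [Hs0 Hs1].
  assert (Hb1 : -1 < b < 1) by (destruct (Rabs_def2 _ _ Hb); lra).
  replace s with (frac_part s + IZR (Int_part s)) by (unfold frac_part; ring).
  replace (frac_part s + IZR (Int_part s) + b)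
    with (frac_part s + b + IZR (Int_part s)) by ring.
  rewrite !(shift_IZR h H1).
  replace (h (frac_part s + b) + IZR (Int_part s)
    - (h (frac_part s) + IZR (Int_part s)))
    with (h (frac_part s + b) - h (frac_part s)) by ring.
  apply Hd; [lra | lra |].
  replace (frac_part s + b - frac_part s) with b by ring. lra.
Qed.

(** * Mean value inequality and distortion in the complex domain *)

Lemma Re_mult_RtoC (r : R) (z : C) : Re (RtoC r * z) = r * Re z.
Proof. destruct z; simpl; ring. Qed.

Lemma Re_minus (z w : C) : Re (z - w) = Re z - Re w.
Proof. destruct z, w; reflexivity. Qed.

Lemma is_derive_C_expansion (f : C -> C) (z f' : C) :
  is_derive (K := C_AbsRing) (V := C_NormedModule) f z f' ->
  forall eps : R, 0 < eps -> exists delta : R, 0 < delta /\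
    forall w : C, Cmod (w - z) < delta ->
    Cmod (f w - f z - (w - z) * f') <= eps * Cmod (w - z).
Proof.
  intros [_ H] eps Heps.
  destruct (H z (fun P HP => HP) (mkposreal eps Heps)) as [d Hd].
  exists d. split; [apply cond_pos|]. intros w Hw. exact (Hd w Hw).
Qed.

(** Pairing with [v] reduces a complex-valued function on a segment to a real
    one, to which the mean value theorem applies. *)
Lemma is_derive_along_line (f : C -> C) (p d v f' : C) (t : R) :
  is_derive (K := C_AbsRing) (V := C_NormedModule) f (p + t * d)%C f' ->
  is_derive (fun s : R => Re (Cconj v * f (p + s * d)%C)) t
    (Re (Cconj v * (f' * d))).
Proof.
  intros Hf. apply is_derive_Reals. intros eps Heps.
  pose proof (Cmod_ge_0 v) as Hv. pose proof (Cmod_ge_0 d) as Hd.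
  assert (Hvd : 0 < Cmod v * Cmod d + 1) by nra.
  destruct (is_derive_C_expansion _ _ _ Hf (eps / 2 / (Cmod v * Cmod d + 1)))
    as [eta [Heta H]]; [apply Rdiv_lt_0_compat; lra|].
  assert (Hdelta : 0 < eta / (Cmod d + 1)) by (apply Rdiv_lt_0_compat; lra).
  exists (mkposreal _ Hdelta). intros r Hr0 Hr. simpl in Hr.
  specialize (H (p + (t + r)%R * d)%C).
  replace (p + (t + r)%R * d - (p + t * d))%C with (r * d)%C in H
    by (rewrite RtoC_plus; ring).
  rewrite Cmod_mult, Cmod_R in H.
  assert (Hrp : 0 < Rabs r) by now apply Rabs_pos_lt.
  assert (Hsmall : Rabs r * Cmod d < eta).
  { apply Rmult_lt_compat_r with (r := Cmod d + 1) in Hr; [|lra].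
    unfold Rdiv in Hr. rewrite Rmult_assoc, Rinv_l in Hr by lra. nra. }
  specialize (H Hsmall).
  set (e := (f (p + (t + r)%R * d) - f (p + t * d) - r * d * f')%C) in H.
  replace ((Re (Cconj v * f (p + (t + r)%R * d))%C - Re (Cconj v * f (p + t * d))%C) / r
    - Re (Cconj v * (f' * d))) with (Re (Cconj v * e) / r).
  2:{ replace (Cconj v * e)%C
      with (Cconj v * f (p + (t + r)%R * d) - Cconj v * f (p + t * d)
            - r * (Cconj v * (f' * d)))%C by (unfold e; ring).
      rewrite !Re_minus, Re_mult_RtoC. field. assumption. }
  rewrite Rabs_div by assumption.
  apply Rmult_lt_reg_r with (Rabs r); [assumption|].
  unfold Rdiv at 1. rewrite Rmult_assoc, Rinv_l, Rmult_1_r by lra.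
  eapply Rle_lt_trans; [apply re_le_Cmod|].
  rewrite Cmod_mult, Cmod_conj.
  apply Rle_lt_trans with
    (Cmod v * (eps / 2 / (Cmod v * Cmod d + 1) * (Rabs r * Cmod d))).
  { now apply Rmult_le_compat_l. }
  replace (Cmod v * (eps / 2 / (Cmod v * Cmod d + 1) * (Rabs r * Cmod d)))
    with (eps * Rabs r * (/ 2 * (Cmod v * Cmod d / (Cmod v * Cmod d + 1))))
    by (field; lra).
  assert (Hq : Cmod v * Cmod d / (Cmod v * Cmod d + 1) <= 1).
  { apply Rmult_le_reg_r with (Cmod v * Cmod d + 1); [lra|].
    unfold Rdiv. rewrite Rmult_assoc, Rinv_l by lra. lra. }
  assert (0 < eps * Rabs r) by nra. nra.
Qed.

(** The pairing is made with the vector [v = f z - f p - D (z - p)] itself: the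
    mean value theorem then gives [|v|^2 <= |v| M |z - p|]. *)
Lemma mean_value_C (f f' : C -> C) (p z D : C) (M : R) :
  (forall t : R, 0 <= t <= 1 ->
     is_derive (K := C_AbsRing) (V := C_NormedModule) f
       (p + t * (z - p))%C (f' (p + t * (z - p))%C)) ->
  (forall t : R, 0 <= t <= 1 -> Cmod (f' (p + t * (z - p))%C - D) <= M) ->
  Cmod (f z - f p - D * (z - p)) <= M * Cmod (z - p).
Proof.
  intros Hf HM. set (d := (z - p)%C) in *.
  set (v := (f z - f p - D * d)%C).
  set (phi := fun s : R => Re (Cconj v * f (p + s * d)%C)).
  set (dphi := fun s : R => Re (Cconj v * (f' (p + s * d)%C * d))).
  assert (Hphi : forall t, 0 <= t <= 1 -> is_derive phi t (dphi t)).
  { intros t Ht. apply is_derive_along_line, Hf, Ht. }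
  destruct (MVT_gen phi 0 1 dphi) as [t [Ht E]].
  - rewrite Rmin_left, Rmax_right by lra. intros t Ht. apply Hphi. lra.
  - rewrite Rmin_left, Rmax_right by lra. intros t Ht.
    apply continuity_pt_filterlim, (ex_derive_continuous phi).
    eexists. now apply Hphi.
  - rewrite Rmin_left, Rmax_right in Ht by lra.
    unfold phi, dphi in E.
    replace (p + 1 * d)%C with z in E by (unfold d; ring).
    replace (p + 0 * d)%C with p in E by ring.
    assert (Hsq : Cmod v * Cmod v = Re (Cconj v * ((f' (p + t * d)%C - D) * d))).
    { transitivity (Re (Cconj v * v)).
      - rewrite Cmult_comm, <- Cmod2_conj. simpl. ring.
      - unfold v at 2.
        replace (Cconj v * (f z - f p - D * d))%C
          with (Cconj v * f z - Cconj v * f p - Cconj v * (D * d))%C by ring.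
        replace (Cconj v * ((f' (p + t * d) - D) * d))%C
          with (Cconj v * (f' (p + t * d) * d) - Cconj v * (D * d))%C by ring.
        rewrite !Re_minus. lra. }
    pose proof (re_le_Cmod (Cconj v * ((f' (p + t * d)%C - D) * d))) as H.
    rewrite !Cmod_mult, Cmod_conj in H.
    pose proof (Rle_abs (Re (Cconj v * ((f' (p + t * d)%C - D) * d)))) as Ha.
    rewrite <- Hsq in Ha.
    pose proof (HM t Ht) as Hm. pose proof (Cmod_ge_0 v). pose proof (Cmod_ge_0 d).
    destruct (Req_dec (Cmod v) 0) as [E0|E0].
    + rewrite E0. pose proof (Cmod_ge_0 (f' (p + t * d)%C - D)). nra.
    + apply Rmult_le_reg_l with (Cmod v); [lra|].
      eapply Rle_trans; [exact Ha|]. rewrite <- Hsq in H.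
      eapply Rle_trans; [exact H|].
      apply Rmult_le_compat_l; [assumption|].
      now apply Rmult_le_compat_r.
Qed.

Lemma Cexp_plus (z w : C) : Cexp (z + w) = (Cexp z * Cexp w)%C.
Proof.
  destruct z as [a b], w as [c d]. unfold Cexp. simpl.
  rewrite exp_plus, cos_plus, sin_plus. unfold Cmult. simpl. f_equal; ring.
Qed.

Lemma exp_minus_1_bound (a : R) :
  Rabs a <= 1 / 100 -> (exp a - 1) ^ 2 <= (105 / 100) * a ^ 2 /\ exp a <= 102 / 100.
Proof.
  intros Ha. assert (-1/100 <= a <= 1/100) as Hb.
  { revert Ha. unfold Rabs. destruct Rcase_abs; lra. }
  pose proof (exp_ineq1_le a) as H1. pose proof (exp_ineq1_le (- a)) as H2.
  rewrite exp_Ropp in H2.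
  assert (H3 : exp a * (1 - a) <= 1).
  { pose proof (exp_pos a). apply Rmult_le_compat_l with (r := exp a) in H2; [|lra].
    rewrite Rinv_r in H2 by lra. lra. }
  assert (exp a <= 102 / 100) by nra.
  split; [|assumption].
  destruct (Rle_dec 0 a).
  - assert (0 <= exp a - 1 <= 102 / 100 * a) by (split; nra).
    nra.
  - assert (exp a <= 1) by (rewrite <- exp_0; left; apply exp_increasing; lra).
    nra.
Qed.

Lemma one_minus_cos_le (b : R) : 2 * (1 - cos b) <= b ^ 2.
Proof.
  replace b with (2 * (b / 2)) at 1 by field.
  rewrite cos_2a_sin.
  assert (Rabs (sin (b / 2)) <= Rabs (b / 2)).
  { assert (Hpos : forall x, 0 <= x -> Rabs (sin x) <= x).
    { intros x [Hx | <-]; [|rewrite sin_0, Rabs_R0; lra].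
      pose proof (sin_lt_x x Hx).
      destruct (Rle_dec x PI) as [Hp|Hp].
      - rewrite Rabs_pos_eq; [lra|]. apply sin_ge_0; lra.
      - pose proof (SIN_bound x). pose proof PI2_1. pose proof PI_4.
        unfold Rabs; destruct Rcase_abs; lra. }
    destruct (Rle_dec 0 (b / 2)).
    - rewrite (Rabs_pos_eq (b / 2)) by lra. now apply Hpos.
    - rewrite <- (Rabs_Ropp (b / 2)), <- (Rabs_Ropp (sin _)), <- sin_neg.
      rewrite (Rabs_pos_eq (- (b / 2))) by lra. apply Hpos. lra. }
  pose proof (Rabs_pos (sin (b / 2))).
  assert (Rabs (sin (b / 2)) ^ 2 <= Rabs (b / 2) ^ 2) by nra.
  rewrite !RPow_abs, !Rabs_pos_eq in * by apply pow2_ge_0.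
  nra.
Qed.

Lemma Cexp_minus_1_bound (z : C) :
  Cmod z <= 1 / 100 -> Cmod (Cexp z - 1) <= 1.03 * Cmod z.
Proof.
  intros Hz. pose proof (re_le_Cmod z) as Hre.
  pose proof (Cmod_ge_0 z) as H0. pose proof (Cmod_ge_0 (Cexp z - 1)).
  assert (Hsq : Cmod (Cexp z - 1) ^ 2 <= (1.03 * Cmod z) ^ 2).
  { destruct z as [a b]. change (Re (a, b)) with a in Hre.
    destruct (exp_minus_1_bound a) as [H1 H2]; [lra|].
    unfold Cmod.
    rewrite Rpow_mult_distr, !pow2_sqrt
      by (apply Rplus_le_le_0_compat; apply pow2_ge_0).
    simpl.
    pose proof (one_minus_cos_le b). pose proof (exp_pos a).
    pose proof (sin2_cos2 b) as Hsc. unfold Rsqr in Hsc.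
    match goal with |- ?x <= _ => replace x
      with ((exp a - 1) ^ 2 + exp a * (2 * (1 - cos b))
            + exp a ^ 2 * (sin b * sin b + cos b * cos b - 1)) by ring end.
    rewrite Hsc.
    assert (0 <= 2 * (1 - cos b)) by (pose proof (COS_bound b); lra).
    assert (exp a * (2 * (1 - cos b)) <= 102 / 100 * b ^ 2).
    { apply Rmult_le_compat; lra. }
    simpl in *. nra. }
  nra.
Qed.

Lemma strip_segment (Delta : R) (p z : C) (t : R) :
  strip Delta p -> strip Delta z -> 0 <= t <= 1 ->
  strip Delta (p + t * (z - p))%C.
Proof.
  unfold strip. destruct p as [p1 p2], z as [z1 z2]. simpl.
  intros H1 H2 Ht.
  apply Rabs_def2 in H1. apply Rabs_def2 in H2.
  destruct (Rle_dec t (1 / 2)); apply Rabs_def1; nra.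
Qed.

(** On the segment, [log DG] varies by at most [eps |z - p|], so [DG] stays
    within relative distance [1.03 eps |z - p|] of its value at [p]. *)
Lemma distortion (Delta eps : R) (G l L : C -> C) (p z : C) :
  (forall w : C, strip Delta w ->
     is_derive (K := C_AbsRing) (V := C_NormedModule) G w (Cexp (l w)) /\
     is_derive (K := C_AbsRing) (V := C_NormedModule) l w (L w)) ->
  (forall w : C, strip Delta w -> Cmod (L w) <= eps) ->
  strip Delta p -> strip Delta z -> eps * Cmod (z - p) <= 1 / 100 ->
  Cmod (G z - G p - Cexp (l p) * (z - p))
  <= 1.03 * eps * Cmod (z - p) * Cmod (Cexp (l p)) * Cmod (z - p).
Proof.
  intros HG HL Hp Hz Hsmall.
  assert (Heps : 0 <= eps).
  { eapply Rle_trans; [apply (Cmod_ge_0 (L p))|]. now apply HL. }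
  pose proof (Cmod_ge_0 (z - p)) as Hd.
  apply mean_value_C with (f' := fun w => Cexp (l w)).
  { intros t Ht. apply HG. now apply strip_segment. }
  intros t Ht. set (w := (p + t * (z - p))%C).
  assert (Hw : strip Delta w) by now apply strip_segment.
  assert (Ew : (w - p)%C = (t * (z - p))%C) by (unfold w; ring).
  assert (Hl : Cmod (l w - l p) <= eps * Cmod (z - p)).
  { apply Rle_trans with (eps * Cmod (w - p)).
    - replace (l w - l p)%C with (l w - l p - 0 * (w - p))%C by ring.
      apply mean_value_C with (f' := L); intros s Hs.
      + apply HG. now apply strip_segment.
      + replace (L (p + s * (w - p))%C - 0)%C with (L (p + s * (w - p))%C) by ring.
        apply HL. now apply strip_segment.
    - rewrite Ew, Cmod_mult, Cmod_R, Rabs_pos_eq by lra.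
      apply Rmult_le_compat_l; nra. }
  replace (Cexp (l w) - Cexp (l p))%C
    with (Cexp (l p) * (Cexp (l w - l p) - 1))%C.
  2:{ replace (l w) with (l p + (l w - l p))%C at 2 by ring.
      rewrite Cexp_plus. ring. }
  rewrite Cmod_mult.
  pose proof (Cexp_minus_1_bound (l w - l p) ltac:(lra)) as He.
  pose proof (Cmod_ge_0 (Cexp (l p))).
  assert (Cmod (Cexp (l w - l p) - 1) <= 1.03 * eps * Cmod (z - p)) by lra.
  nra.
Qed.

Lemma C0_norm_bound (K : C -> Prop) (f : C -> C) (eps : R) :
  Rbar_lt (C0_norm K f) eps -> forall z : C, K z -> Cmod (f z) <= eps.
Proof.
  intros H z Hz. destruct (Lub_Rbar_correct
    (fun r : R => exists z : C, K z /\ r = Cmod (f z))) as [Hub _].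
  specialize (Hub (Cmod (f z)) (ex_intro _ z (conj Hz eq_refl))).
  unfold C0_norm in H.
  pose proof (Rbar_le_lt_trans _ _ _ Hub H) as Hlt. simpl in Hlt. lra.
Qed.

(** * Shadowing of a real orbit by a complex one *)

(** Dividing [w' = D w (1 + delta)] by [mu' = D mu (1 + theta)] cancels [D],
    the only quantity that is not close to 1; it is never estimated. *)
Lemma ratio_distortion (eps B : R) (D w w' mu mu' : C) :
  0 <= eps -> eps * Cmod mu <= 1 / 100 -> 0 <= B ->
  mu <> RtoC 0 -> mu' <> RtoC 0 ->
  Cmod (w / mu) <= B ->
  Cmod (w' - D * w) <= 1.03 * eps * Cmod w * Cmod D * Cmod w ->
  Cmod (mu' - D * mu) <= 1.03 * eps * Cmod mu * Cmod D * Cmod mu ->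
  Cmod (w' / mu' - w / mu) <= 1.05 * eps * (B + 1) * Cmod mu * Cmod (w / mu).
Proof.
  intros Heps Hmu HB Hmu0 Hmu'0 Hv Hw' Hmu'.
  set (v := (w / mu)%C) in *.
  assert (Ew : w = (mu * v)%C) by (unfold v; field; assumption).
  replace (w' / mu' - v)%C with (((w' - D * w) - v * (mu' - D * mu)) / mu')%C
    by (rewrite Ew; field; assumption).
  rewrite Cmod_div by assumption.
  pose proof (proj1 (Cmod_gt_0 mu) Hmu0) as Pmu.
  pose proof (proj1 (Cmod_gt_0 mu') Hmu'0) as Pmu'.
  pose proof (Cmod_ge_0 v) as Pv. pose proof (Cmod_ge_0 D) as PD.
  assert (HD : Cmod D * Cmod mu <= 1.0105 * Cmod mu').
  { pose proof (Cmod_triangle mu' (- (mu' - D * mu))) as H.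
    replace (mu' + - (mu' - D * mu))%C with (D * mu)%C in H by ring.
    rewrite Cmod_opp, Cmod_mult in H.
    assert (eps * Cmod mu * (Cmod D * Cmod mu) <= 1 / 100 * (Cmod D * Cmod mu))
      by (apply Rmult_le_compat_r; [apply Rmult_le_pos|]; lra).
    lra. }
  apply Rmult_le_reg_r with (Cmod mu'); [assumption|].
  unfold Rdiv. rewrite Rmult_assoc, Rinv_l, Rmult_1_r by lra.
  apply Rle_trans with
    (1.03 * eps * Cmod mu * Cmod v * (Cmod v + 1) * (Cmod D * Cmod mu)).
  { eapply Rle_trans; [apply Cmod_triangle|]. rewrite Cmod_opp, Cmod_mult.
    rewrite Ew in Hw' at 2 3. rewrite Cmod_mult in Hw'.
    pose proof (Rmult_le_compat_l _ _ _ Pv Hmu'). lra. }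
  assert (0 <= 1.03 * eps * Cmod mu * Cmod v) by (repeat (lra || apply Rmult_le_pos)).
  apply Rle_trans with
    (1.03 * eps * Cmod mu * Cmod v * (B + 1) * (1.0105 * Cmod mu')).
  { apply Rmult_le_compat; [nra | nra | | assumption].
    apply Rmult_le_compat_l; lra. }
  assert (0 <= eps * Cmod mu * Cmod v * (B + 1) * Cmod mu')
    by (repeat (lra || apply Rmult_le_pos)).
  lra.
Qed.

Lemma exp_0_54_le : exp 0.54 <= 1.88.
Proof.
  (* [exp 0.27 <= 1 / (1 - 0.27)], squared. *)
  replace 0.54 with (0.27 + 0.27) by lra. rewrite exp_plus.
  pose proof (exp_ineq1_le (Ropp 0.27)) as H. rewrite exp_Ropp in H.
  pose proof (exp_pos 0.27) as Hp.
  apply Rmult_le_compat_l with (r := exp 0.27) in H; [|lra].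
  rewrite Rinv_r in H by lra. assert (exp 0.27 <= 1.37) by lra. nra.
Qed.

(** A discrete Gronwall inequality.  The bound on a step is only required where
    the conclusion already holds, since in the application the estimate of a
    step depends on the size reached before it. *)
Lemma multiplicative_perturbation (v : nat -> C) (a : nat -> R) (j : nat) :
  (forall i : nat, 0 <= a i) ->
  (forall i : nat, (i < j)%nat ->
     Cmod (v i - v O) <= Cmod (v O) * (exp (sum_below a i) - 1) ->
     Cmod (v (S i) - v i) <= a i * Cmod (v i)) ->
  Cmod (v j - v O) <= Cmod (v O) * (exp (sum_below a j) - 1).
Proof.
  intros Ha. induction j as [|j IH]; intros Hstep.
  - simpl. replace (v O - v O)%C with (RtoC 0) by ring.
    rewrite Cmod_0, exp_0. lra.
  - assert (Hj : Cmod (v j - v O) <= Cmod (v O) * (exp (sum_below a j) - 1)).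
    { apply IH. intros i Hi. apply Hstep. lia. }
    specialize (Hstep j (Nat.lt_succ_diag_r j) Hj).
    pose proof (Cmod_triangle (v (S j) - v j) (v j - v O)) as Ht1.
    replace (v (S j) - v j + (v j - v O))%C with (v (S j) - v O)%C in Ht1 by ring.
    pose proof (Cmod_triangle (v j - v O) (v O)) as Ht2.
    replace (v j - v O + v O)%C with (v j) in Ht2 by ring.
    simpl. rewrite exp_plus.
    pose proof (exp_ineq1_le (a j)) as He. pose proof (exp_pos (sum_below a j)).
    specialize (Ha j). pose proof (Cmod_ge_0 (v O)) as H0.
    assert (Cmod (v j) <= Cmod (v O) * exp (sum_below a j)) by lra.
    assert (a j * Cmod (v j) <= a j * (Cmod (v O) * exp (sum_below a j)))
      by now apply Rmult_le_compat_l.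
    assert (Cmod (v O) * exp (sum_below a j) * (1 + a j)
      <= Cmod (v O) * exp (sum_below a j) * exp (a j)).
    { apply Rmult_le_compat_l; [|assumption]. apply Rmult_le_pos; lra. }
    lra.
Qed.

(** The points [z i = x i + mu i * v i] are followed through the ratios [v i].
    Each step changes [v i] by a relative error
    [1.05 eps (2 |v0| + 1) |mu i| <= 0.54 |mu i|], because [eps |v0| <= 1/4]
    and [eps <= 1/100]; and the [|mu i|] add up to at most 1.  As
    [exp 0.54 - 1 <= 0.88 < 1], the bound [|v i| <= 2 |v0|] used in this
    estimate is preserved and the ratio never gets close to 0. *)
Lemma orbit_shadowing (Delta eps : R) (G l L : C -> C) (x mu : nat -> R)
  (z0 v0 : C) (N : nat) :
  (forall w : C, strip Delta w ->
     is_derive (K := C_AbsRing) (V := C_NormedModule) G w (Cexp (l w)) /\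
     is_derive (K := C_AbsRing) (V := C_NormedModule) l w (L w)) ->
  (forall w : C, strip Delta w -> Cmod (L w) <= eps) ->
  eps <= 1 / 100 -> eps * Cmod v0 <= 1 / 4 ->
  (forall i : nat, G (x i) = x (S i)) ->
  (forall i : nat, G (x i + mu i)%R = (x (S i) + mu (S i))%R) ->
  (forall i : nat, mu i <> 0) ->
  (forall i : nat, Rabs (mu i) <= 1) ->
  (forall i : nat, Rabs (mu i) * (2 * Cmod v0) <= 1) ->
  (forall i : nat, Rabs (mu i) * (2 * Cmod v0) < Delta) ->
  sum_below (fun i => Rabs (mu i)) N <= 1 ->
  z0 = (x O + mu O * v0)%C ->
  forall j : nat, (j <= N)%nat ->
  exists v : C, Nat.iter j G z0 = (x j + mu j * v)%C /\
    strip Delta (Nat.iter j G z0) /\ Cmod (v - v0) <= 0.88 * Cmod v0.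
Proof.
  intros HG HL Heps Hepsv Hx Hxmu Hmu0 Hmu1 Hmuv HmuD Hsum Hz0.
  pose proof (Cmod_ge_0 v0) as Hv0.
  assert (HD : 0 < Delta).
  { specialize (HmuD O). pose proof (Rabs_pos (mu O)). nra. }
  assert (Hreal : forall s : R, strip Delta s).
  { intros s. unfold strip. simpl. now rewrite Rabs_R0. }
  assert (Heps0 : 0 <= eps).
  { eapply Rle_trans; [apply (Cmod_ge_0 (L (x O)))|]. now apply HL. }
  assert (Hmuc : forall i, RtoC (mu i) <> RtoC 0).
  { intros i E. injection E. apply Hmu0. }
  set (z := fun i => Nat.iter i G z0).
  set (v := fun i => ((z i - x i) / mu i)%C).
  assert (Ez : forall i, z i = (x i + mu i * v i)%C).
  { intros i. unfold v. field. apply Hmuc. }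
  assert (Ev0 : v O = v0).
  { unfold v, z. simpl. rewrite Hz0. field. apply Hmuc. }
  set (a := fun i => 0.54 * Rabs (mu i)).
  assert (Hexp : forall i, (i <= N)%nat -> exp (sum_below a i) <= 1.88).
  { intros i Hi. apply Rle_trans with (exp 0.54); [|exact exp_0_54_le].
    unfold a. rewrite sum_below_scal.
    pose proof (sum_below_mono (fun i => Rabs (mu i)) i N
      (fun i => Rabs_pos (mu i)) Hi) as Hm. simpl in Hm.
    destruct (Rle_lt_or_eq_dec (0.54 * sum_below (fun i => Rabs (mu i)) i) 0.54)
      as [Hlt | Heq]; [lra | left; now apply exp_increasing | rewrite Heq; lra]. }
  assert (Hstrip : forall i, Cmod (v i - v0) <= 0.88 * Cmod v0 ->
    Cmod (v i) <= 2 * Cmod v0 /\ strip Delta (z i)).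
  { intros i Hi. pose proof (Cmod_triangle (v i - v0) v0) as Ht.
    replace (v i - v0 + v0)%C with (v i) in Ht by ring.
    split; [lra|]. unfold strip. rewrite Ez.
    replace (Im (x i + mu i * v i)%C) with (Im (mu i * v i)%C) by (simpl; ring).
    replace (Im (mu i * v i)%C) with (mu i * Im (v i)) by (simpl; ring).
    rewrite Rabs_mult. eapply Rle_lt_trans; [|apply (HmuD i)].
    apply Rmult_le_compat_l; [apply Rabs_pos|].
    assert (Rabs (Im (v i)) <= Cmod (v i)).
    { eapply Rle_trans; [|apply Rmax_Cmod]. apply Rmax_r. }
    lra. }
  assert (Hmain : forall j, (j <= N)%nat ->
    Cmod (v j - v0) <= Cmod v0 * (exp (sum_below a j) - 1)).
  { intros j Hj. rewrite <- Ev0. apply multiplicative_perturbation.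
    - intros i. unfold a. pose proof (Rabs_pos (mu i)). lra.
    - intros i Hi Hvi. rewrite Ev0 in Hvi.
      pose proof (Hexp i ltac:(lia)) as He.
      destruct (Hstrip i) as [Hv Hzi]; [nra|].
      specialize (Hmu1 i). specialize (Hmuv i).
      pose proof (Rabs_pos (mu i)) as Hp. pose proof (Cmod_ge_0 (v i)) as Hvp.
      apply Rle_trans with
        (1.05 * eps * (2 * Cmod v0 + 1) * Cmod (mu i) * Cmod (v i)).
      + assert (Hzx : Cmod (z i - x i) <= 1).
        { rewrite Ez. replace (x i + mu i * v i - x i)%C with (mu i * v i)%C by ring.
          rewrite Cmod_mult, Cmod_R. nra. }
        pose proof (Cmod_ge_0 (z i - x i)).
        assert (Hsmall : eps * Cmod (mu i) <= 1 / 100) by (rewrite Cmod_R; nra).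
        unfold v at 1 2. apply ratio_distortion with (D := Cexp (l (x i)));
          try assumption; try lra; try apply Hmuc.
        * pose proof (distortion Delta eps G l L (x i) (z i) HG HL
            (Hreal _) Hzi ltac:(nra)) as H1.
          rewrite Hx in H1. exact H1.
        * assert (Emu : (x i + mu i - x i)%C = mu i) by ring.
          pose proof (distortion Delta eps G l L (x i) (x i + mu i)%R HG HL
            (Hreal _) (Hreal _)) as H1.
          rewrite Hx, Hxmu, !RtoC_plus, Emu in H1.
          replace (x (S i) + mu (S i) - x (S i))%C with (RtoC (mu (S i))) in H1 by ring.
          apply H1. exact Hsmall.
      + rewrite Cmod_R. unfold a.
        apply Rmult_le_compat_r; [assumption|].
        apply Rmult_le_compat_r; [assumption|]. lra. }
  intros j Hj. exists (v j).
  assert (Hv : Cmod (v j - v0) <= 0.88 * Cmod v0).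
  { pose proof (Hmain j Hj). pose proof (Hexp j Hj). nra. }
  split; [apply Ez|]. split; [now apply Hstrip | assumption].
Qed.

(** * The displacements of a conjugate of a rotation *)

Lemma conjugacy_step (g h hinv : R -> R) :
  conjugacy g h hinv ->
  forall t : R, g (h t) = h (t + rotation_number g).
Proof.
  intros (_ & [_ Hr] & _ & _ & _ & Hg) t. now rewrite <- Hg, Hr.
Qed.

Lemma conjugacy_iter (g h hinv : R -> R) :
  conjugacy g h hinv ->
  forall (k : nat) (t : R),
  Nat.iter k g (h t) = h (t + INR k * rotation_number g).
Proof.
  intros Hc k t. induction k as [|k IH].
  - simpl. f_equal. ring.
  - rewrite S_INR. simpl Nat.iter. rewrite IH, (conjugacy_step g h hinv Hc).
    f_equal. ring.
Qed.

Lemma m_conjugacy (g h hinv : R -> R) :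
  conjugacy g h hinv ->
  forall (n : nat) (t : R),
  m g n (h t) = h (t + beta (rotation_number g) n) - h t.
Proof.
  intros Hc n t. unfold m. rewrite (conjugacy_iter g h hinv Hc).
  destruct Hc as (_ & _ & _ & _ & H1 & _).
  replace (t + INR (cf_den (rotation_number g) n) * rotation_number g)
    with (t + beta (rotation_number g) n + IZR (cf_num (rotation_number g) n))
    by (unfold beta; ring).
  rewrite (shift_IZR h H1). ring.
Qed.

Lemma m_sign (g h hinv : R -> R) (n : nat) :
  irrational (rotation_number g) -> conjugacy g h hinv ->
  (forall t : R, 0 < m g n (h t)) \/ (forall t : R, m g n (h t) < 0).
Proof.
  intros Ha Hc. pose proof Hc as (Hh & _).
  destruct (Rtotal_order (beta (rotation_number g) n) 0) as [Hb | [E | Hb]].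
  - right. intros t. rewrite (m_conjugacy g h hinv Hc).
    pose proof (Hh (t + beta (rotation_number g) n) t ltac:(lra)). lra.
  - now apply beta_neq_0 in E.
  - left. intros t. rewrite (m_conjugacy g h hinv Hc).
    pose proof (Hh t (t + beta (rotation_number g) n) ltac:(lra)). lra.
Qed.

(** When [beta] is negative the intervals [[x + m, x]] are described from their
    left end point, that is from a starting point translated by [beta]. *)
Lemma sum_m_orbit_le_1 (g h hinv : R -> R) (n : nat) (t : R) :
  irrational (rotation_number g) -> conjugacy g h hinv ->
  sum_below (fun i => Rabs (m g n (h (t + INR i * rotation_number g))))
    (cf_den (rotation_number g) (S n)) <= 1.
Proof.
  intros Ha Hc. pose proof Hc as (Hh & _ & _ & _ & H1 & _).
  set (a := rotation_number g) in *. set (b := beta a n).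
  pose proof (Rabs_beta_le_1 a n Ha) as Hb1. fold b in Hb1.
  pose proof (Rabs_pos b) as Hb0.
  assert (Hsep : forall (k : nat) (p : Z), (0 < k < cf_den a (S n))%nat ->
    Rabs b <= Rabs (INR k * a - IZR p)).
  { intros k p Hk. now apply best_approximation. }
  assert (Hm : forall s, m g n (h s) = h (s + b) - h s)
    by exact (m_conjugacy g h hinv Hc n).
  destruct (Rle_dec 0 b) as [Hb|Hb].
  - rewrite (sum_below_ext _
      (fun i => h (t + INR i * a + Rabs b) - h (t + INR i * a))).
    + now apply sum_increments_le_1.
    + intros i _. rewrite Hm, (Rabs_pos_eq b Hb).
      destruct Hb as [Hb | <-].
      * pose proof (Hh (t + INR i * a) (t + INR i * a + b) ltac:(lra)).
        rewrite Rabs_pos_eq; lra.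
      * rewrite Rplus_0_r, Rminus_diag, Rabs_R0. reflexivity.
  - rewrite (sum_below_ext _
      (fun i => h (t + b + INR i * a + Rabs b) - h (t + b + INR i * a))).
    + now apply sum_increments_le_1.
    + intros i _. rewrite Hm, (Rabs_left b) by lra.
      replace (t + b + INR i * a + - b) with (t + INR i * a) by ring.
      replace (t + b + INR i * a) with (t + INR i * a + b) by ring.
      pose proof (Hh (t + INR i * a + b) (t + INR i * a) ltac:(lra)).
      rewrite Rabs_left; lra.
Qed.

Lemma m_cvg_0 (g h hinv : R -> R) :
  irrational (rotation_number g) -> conjugacy g h hinv ->
  forall eta : R, 0 < eta ->
  exists N : nat, forall n : nat, (N <= n)%nat ->
  forall t : R, Rabs (m g n (h t)) < eta.
Proof.
  intros Ha Hc eta Heta. pose proof Hc as (_ & _ & Hcont & _ & H1 & _).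
  destruct (uniform_continuity_circle h Hcont H1 eta Heta) as [d [Hd Hh]].
  destruct (beta_cvg_0 _ Ha d Hd) as [N HN].
  exists N. intros n Hn t. rewrite (m_conjugacy g h hinv Hc). now apply Hh, HN.
Qed.

(** * Poincare distance and conclusion *)

(** The Euclidean segment is a path of speed [|w - z|] above height [r]. *)
Lemma poincare_dist_segment (z w : C) (r : R) :
  0 < r -> r <= Im z -> r <= Im w ->
  Rbar_le (poincare_dist z w) (Cmod (w - z) / r).
Proof.
  intros Hr Hz Hw. destruct z as [x a], w as [x' b]. simpl in Hz, Hw.
  set (X := fun t => x + t * (x' - x)). set (Y := fun t => a + t * (b - a)).
  assert (HX : forall t, is_derive X t (x' - x))
    by (intros t; unfold X; auto_derive; [exact I|ring]).
  assert (HY : forall t, is_derive Y t (b - a))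
    by (intros t; unfold Y; auto_derive; [exact I|ring]).
  assert (DX : forall t, Derive X t = x' - x) by (intros t; now apply is_derive_unique).
  assert (DY : forall t, Derive Y t = b - a) by (intros t; now apply is_derive_unique).
  assert (HYr : forall t, 0 <= t <= 1 -> r <= Y t) by (intros t Ht; unfold Y; nra).
  set (K := Cmod ((x', b) - (x, a))).
  assert (EK : sqrt ((x' - x) ^ 2 + (b - a) ^ 2) = K).
  { unfold K, Cmod. simpl. f_equal; ring. }
  assert (HK : 0 <= K) by apply Cmod_ge_0.
  assert (Hlen : hyperbolic_length X Y <= K / r).
  { unfold hyperbolic_length.
    rewrite (RInt_ext _ (fun t => K / Y t)).
    2:{ intros t _. now rewrite DX, DY, EK. }
    replace (K / r) with (RInt (fun _ => K / r) 0 1)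
      by (rewrite RInt_const; unfold scal; simpl; unfold mult; simpl; ring).
    apply RInt_le; [lra | | apply ex_RInt_const |].
    - apply (ex_RInt_continuous (fun t => K / Y t)). intros t Ht.
      rewrite Rmin_left, Rmax_right in Ht by lra.
      apply (ex_derive_continuous (fun t => K / Y t)).
      specialize (HYr t Ht). unfold Y in *. auto_derive. lra.
    - intros t Ht. apply Rmult_le_compat_l; [assumption|].
      apply Rinv_le_contravar; [assumption|]. apply HYr. lra. }
  destruct (Glb_Rbar_correct (fun l : R => exists X Y : R -> R,
    half_plane_path (x, a) (x', b) X Y /\ l = hyperbolic_length X Y)) as [Hlb _].
  apply Rbar_le_trans with (hyperbolic_length X Y); [|exact Hlen].
  apply Hlb. exists X, Y. split; [|reflexivity].
  split; [|split].
  - unfold X, Y. f_equal; ring.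
  - unfold X, Y. f_equal; ring.
  - intros t Ht. specialize (HYr t Ht). repeat split.
    + lra.
    + eexists. apply HX.
    + apply continuous_ext with (fun _ : R => x' - x);
        [intros; now rewrite DX | apply continuous_const].
    + eexists. apply HY.
    + apply continuous_ext with (fun _ : R => b - a);
        [intros; now rewrite DY | apply continuous_const].
Qed.

Theorem lemma9 :
  exists eps1 : R, 0 < eps1 /\
  forall eps0 : R, 0 < eps0 <= eps1 ->
  forall D0 : R, 4 < D0 < 1 / (4 * eps0) ->
  forall Delta : R, 0 < Delta ->
  forall (g : R -> R) (G : C -> C),
    Domega_strip Delta g G ->
    irrational (rotation_number g) ->
    holomorphic_on (strip Delta) G ->
    continuous_on (closed_strip Delta) G ->
  forall L : C -> C,
    is_DlogD Delta G L ->
    Rbar_lt (C0_norm (closed_strip Delta) L) eps0 ->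
  forall h hinv : R -> R,
    conjugacy g h hinv ->
  exists (n0 : nat) (C0 : R), (1 <= n0)%nat /\ 0 < C0 /\
  forall n : nat, (n > n0)%nat ->
  forall (z0 : C) (x0 y0 : R),
    strip Delta z0 -> 0 < Im z0 ->
    z0 = (x0, Rabs (m g n x0) * y0) -> 0 < y0 < D0 ->
  forall j : nat, (j <= cf_den (rotation_number g) (S n))%nat ->
    (forall i : nat, (i < j)%nat -> strip Delta (Nat.iter i G z0)) /\
    0 < Im (Nat.iter j G z0) /\
    Rbar_le (poincare_dist (Nat.iter j G z0) (flow_ext g h hinv n (INR j) z0))
            C0.
Proof.
  exists (1 / 100). split; [lra|].
  intros eps [Heps0 Heps] D0 [HD4 HD0] Delta HDelta g G (_ & HGg & _) Ha _ _
    L [[l HG] _] HLlt h hinv Hc.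
  assert (HD0eps : eps * D0 <= 1 / 4).
  { apply Rmult_lt_compat_l with (r := eps) in HD0; [|assumption].
    replace (eps * (1 / (4 * eps))) with (1 / 4) in HD0 by (field; lra). lra. }
  assert (HL : forall w, strip Delta w -> Cmod (L w) <= eps).
  { intros w Hw. apply (C0_norm_bound _ _ _ HLlt).
    unfold strip, closed_strip in *. lra. }
  (* The ratios [v i] stay below [2 y0 < 2 D0] in modulus, so displacements
     smaller than [eta] keep the orbit in the strip, at distance at most 1 from
     the real one. *)
  set (eta := Rmin 1 Delta / (2 * D0)).
  assert (Heta : 0 < eta).
  { apply Rdiv_lt_0_compat; [apply Rmin_case|]; lra. }
  destruct (m_cvg_0 g h hinv Ha Hc eta Heta) as [N HN].
  exists (S N), 8. split; [lia|]. split; [lra|].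
  intros n Hn z0 x0 y0 _ _ Hz0 Hy0 j Hj.
  set (alpha := rotation_number g) in *.
  set (x := fun i => h (hinv x0 + INR i * alpha)).
  set (mu := fun i => m g n (x i)).
  assert (Hx0 : x O = x0).
  { destruct Hc as (_ & [_ Hr] & _). unfold x. simpl.
    now rewrite Rmult_0_l, Rplus_0_r, Hr. }
  assert (Hsmall : forall i, Rabs (mu i) * (2 * D0) < Rmin 1 Delta).
  { intros i. pose proof (HN n ltac:(lia) (hinv x0 + INR i * alpha)) as H.
    apply Rmult_lt_compat_r with (r := 2 * D0) in H; [|lra].
    unfold eta, Rdiv in H. rewrite Rmult_assoc, Rinv_l, Rmult_1_r in H by lra.
    exact H. }
  assert (Hxg : forall i, g (x i) = x (S i)).
  { intros i. unfold x. rewrite (conjugacy_step g h hinv Hc), S_INR. f_equal.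
    unfold alpha. ring. }
  assert (Hxmu : forall i, x i + mu i = h (hinv x0 + INR i * alpha + beta alpha n)).
  { intros i. unfold mu, x. rewrite (m_conjugacy g h hinv Hc). fold alpha. ring. }
  assert (Hxmug : forall i, g (x i + mu i) = x (S i) + mu (S i)).
  { intros i. rewrite !Hxmu, (conjugacy_step g h hinv Hc), S_INR. f_equal.
    unfold alpha. ring. }
  (* With [sigma] the common sign of the [mu i], the point [x i + i |mu i| y0] is
     [x i + mu i * v0] for the constant [v0 = i sigma y0]: signed [mu i] can thus
     be used throughout, as the recursion on complex ratios requires. *)
  assert (Hsign : exists sigma : R, sigma * sigma = 1 /\
    forall i, Rabs (mu i) = mu i * sigma /\ mu i <> 0).
  { destruct (m_sign g h hinv n Ha Hc) as [Hs|Hs].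
    - exists 1. split; [ring|]. intros i. specialize (Hs (hinv x0 + INR i * alpha)).
      fold (x i) in Hs. fold (mu i) in Hs. rewrite Rabs_pos_eq; lra.
    - exists (-1). split; [ring|]. intros i. specialize (Hs (hinv x0 + INR i * alpha)).
      fold (x i) in Hs. fold (mu i) in Hs. rewrite Rabs_left; lra. }
  destruct Hsign as [sigma [Hsigma Hmu]].
  set (v0 := (0, sigma * y0) : C).
  assert (Hv0 : Cmod v0 = y0).
  { unfold v0, Cmod. simpl.
    replace (0 * (0 * 1) + sigma * y0 * (sigma * y0 * 1))
      with (sigma * sigma * (y0 * y0)) by ring.
    rewrite Hsigma, Rmult_1_l. apply sqrt_square. lra. }
  assert (Hmin : Rmin 1 Delta <= 1 /\ Rmin 1 Delta <= Delta)
    by (split; [apply Rmin_l | apply Rmin_r]).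
  assert (Hmuy : forall i, 0 <= Rabs (mu i) /\
    Rabs (mu i) * (2 * y0) <= Rabs (mu i) * (2 * D0)).
  { intros i. pose proof (Rabs_pos (mu i)). split; [assumption|].
    apply Rmult_le_compat_l; lra. }
  assert (Hmu1 : forall i, Rabs (mu i) <= 1).
  { intros i. pose proof (Hsmall i). destruct (Hmuy i). nra. }
  assert (Hshadow : forall i, (i <= cf_den alpha (S n))%nat ->
    exists v : C, Nat.iter i G z0 = (x i + mu i * v)%C /\
    strip Delta (Nat.iter i G z0) /\ Cmod (v - v0) <= 0.88 * Cmod v0).
  { apply (orbit_shadowing Delta eps G l L x mu); try assumption.
    - rewrite Hv0. assert (eps * y0 <= eps * D0)
        by (apply Rmult_le_compat_l; lra). lra.
    - intros i. now rewrite HGg, Hxg.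
    - intros i. now rewrite HGg, Hxmug, RtoC_plus.
    - intros i. apply Hmu.
    - intros i. rewrite Hv0. pose proof (Hsmall i). destruct (Hmuy i). lra.
    - intros i. rewrite Hv0. pose proof (Hsmall i). destruct (Hmuy i). lra.
    - exact (sum_m_orbit_le_1 g h hinv n (hinv x0) Ha Hc).
    - rewrite Hz0, Hx0. unfold v0. rewrite <- Hx0. fold (mu O).
      rewrite (proj1 (Hmu O)). unfold Cplus, Cmult. simpl. f_equal; ring. }
  split.
  { intros i Hi. destruct (Hshadow i ltac:(lia)) as [v [_ [Hs _]]]. exact Hs. }
  destruct (Hshadow j Hj) as [v [Ez [_ Hv]]]. rewrite Hv0 in Hv.
  set (w := flow_ext g h hinv n (INR j) z0).
  assert (Hpos : 0 < Rabs (mu j)) by (apply Rabs_pos_lt, Hmu).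
  assert (Ew : w = (x j + mu j * v0)%C).
  { unfold w, flow_ext. rewrite Hz0. simpl Re. simpl Im.
    unfold flow. fold alpha. fold (x j). fold (mu j).
    replace (Rabs (m g n x0)) with (Rabs (mu O)) by (unfold mu; now rewrite Hx0).
    pose proof (Rabs_pos_lt _ (proj2 (Hmu O))).
    replace (Rabs (mu O) * y0 / Rabs (mu O)) with y0 by (field; lra).
    rewrite (proj1 (Hmu j)). unfold v0, Cplus, Cmult. simpl. f_equal; ring. }
  assert (Hdist : Cmod (w - Nat.iter j G z0) <= 0.88 * (Rabs (mu j) * y0)).
  { rewrite Ew, Ez.
    replace (x j + mu j * v0 - (x j + mu j * v))%C with (- (mu j * (v - v0)))%C by ring.
    rewrite Cmod_opp, Cmod_mult, Cmod_R.
    apply Rmult_le_compat_l with (r := Rabs (mu j)) in Hv; lra. }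
  assert (HImw : Im w = Rabs (mu j) * y0).
  { rewrite Ew, (proj1 (Hmu j)). unfold v0. simpl. ring. }
  assert (HIm : 0.12 * (Rabs (mu j) * y0) <= Im (Nat.iter j G z0)).
  { assert (Hi : Rabs (Im (w - Nat.iter j G z0)%C) <= Cmod (w - Nat.iter j G z0)).
    { eapply Rle_trans; [|apply Rmax_Cmod]. apply Rmax_r. }
    replace (Im (w - Nat.iter j G z0)%C) with (Im w - Im (Nat.iter j G z0)) in Hi
      by reflexivity.
    pose proof (Rle_abs (Im w - Im (Nat.iter j G z0))). lra. }
  assert (Hh : 0 < Rabs (mu j) * y0) by (apply Rmult_lt_0_compat; lra).
  split; [lra|].
  eapply Rbar_le_trans.
  - apply (poincare_dist_segment _ w (0.12 * (Rabs (mu j) * y0))); lra.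
  - simpl. apply Rmult_le_reg_r with (0.12 * (Rabs (mu j) * y0)); [lra|].
    unfold Rdiv at 1. rewrite Rmult_assoc, Rinv_l, Rmult_1_r by lra. lra.
Qed.
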